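(* If $n$ is sufficiently large, then \[ \mathrm{La}(n,\mathcal{P}_5,\#P_2)=5\binom{n-2}{\lfloor n/2\rfloor-1}=\left(\frac54+o(1)\right)\binom{n}{\lfloor n/2\rfloor}. \]
   Context: $2^{[n]}$ is the Boolean lattice of all subsets of $[n]=\{1,\dots,n\}$ ordered by inclusion. A poset $P$ is a (weak) subposet of a poset $Q$ if there is an injection $f:P\to Q$ such that $p\le_P p'$ implies $f(p)\le_Q f(p')$. $\mathcal{P}_k$ denotes the family of all posets on $k$ elements whose undirected Hasse diagram is a path; a family $\mathcal{F}\subseteq 2^{[n]}$ is $\mathcal{P}_k$-free if no poset of $\mathcal{P}_k$ is a weak subposet of $(\mathcal{F},\subseteq)$. A copy of $P_2$ (the 2-element chain) in $\mathcal{F}$ is a pair $F\subsetneq F'$ with $F,F'\in\mathcal{F}$. $\mathrm{La}(n,\mathcal{P}_k,\#P_2)$ is the maximum number of copies of $P_2$ in a $\mathcal{P}_k$-free family $\mathcal{F}\subseteq 2^{[n]}$. *)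

(* Defs.v *)
From mathcomp Require Import all_boot all_order boolp.

Set Implicit Arguments.
Unset Strict Implicit.
Unset Printing Implicit Defensive.

Definition covers (d : Order.disp_t) (P : finPOrderType d) (x y : P) : bool :=
  (x < y)%O && ~~ [exists z : P, (x < z)%O && (z < y)%O].

Definition hasse_adj (d : Order.disp_t) (P : finPOrderType d) (x y : P) : bool :=
  covers x y || covers y x.

(* Membership in the family of posets on k elements whose undirected Hasse
   diagram is a path: s lists the elements of P along the path. *)
Definition path_poset (k : nat) (d : Order.disp_t) (P : finPOrderType d) : Prop :=
  exists s : 'I_k -> P,
    bijective s /\
    forall i j : 'I_k,
      hasse_adj (s i) (s j) = ((i.+1 == j :> nat) || (j.+1 == i :> nat)).

Definition weak_subposet (d : Order.disp_t) (P : porderType d)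
    (n : nat) (F : {set {set 'I_n}}) : Prop :=
  exists f : P -> {set 'I_n},
    [/\ injective f,
        forall p : P, f p \in F &
        forall p p' : P, (p <= p')%O -> f p \subset f p'].

Definition path_free (k n : nat) (F : {set {set 'I_n}}) : Prop :=
  forall (d : Order.disp_t) (P : finPOrderType d),
    path_poset k P -> ~ weak_subposet P F.

Definition copies_P2 (n : nat) (F : {set {set 'I_n}}) : nat :=
  #|[set p : {set 'I_n} * {set 'I_n} |
      [&& p.1 \in F, p.2 \in F & p.1 \proper p.2]]|.

Definition La_path_P2 (n k : nat) : nat :=
  \max_(F : {set {set 'I_n}} | `[< path_free k F >]) copies_P2 F.

(* Main.v *)
(* A family is P_5-free iff its comparability graph has no path on five vertices.
   Read a permutation as a maximal chain of subsets; a chain cannot meet the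
   convex hulls of two different components of the graph, so it suffices to show
   that a component with m edges has a hull met by at least the fraction
   m / (5 'C(n - 2, n./2 - 1)) of the chains.

   Call a vertex heavy if it has at least three neighbours that are not leaves.
   A component with a heavy vertex has four vertices; it has at most 5 edges and
   contains a 3-chain, or it is a 4-chain with 6 edges. Its hull contains an
   interval [A, D] with #|D :\: A| = d >= 2 (d >= 3 for the 4-chain), and [A, D]
   is met by the fraction 1 / 'C(n - d, #|A|) of the chains.
   In a component without heavy vertices each vertex can be charged with a total
   of one edge. Such a component has at most as many edges as vertices, and
   Bonferroni's inequality shows that it is met by nearly the fraction
   #|K| / 'C(n, n./2) of the chains; this suffices because
   'C(n, n./2) <= 4 'C(n - 2, n./2 - 1) leaves a factor 5/4 to spare. *)

From HB Require Import structures.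
Require Import Defs.
From mathcomp Require Import all_boot all_order all_algebra all_fingroup zify.

Set Implicit Arguments.
Unset Strict Implicit.
Unset Printing Implicit Defensive.

(** * Binomial coefficients *)

Lemma bin_le_central n i : 'C(n, i) <= 'C(n, n./2).
Proof.
have step j : j.+1 <= n./2 -> 'C(n, j) <= 'C(n, j.+1).
  move=> jn; have := mul_bin_left n j; nia.
have low j : j <= n./2 -> 'C(n, j) <= 'C(n, n./2).
  move=> jn; rewrite -(subKn jn).
  elim: (n./2 - j) => [|d IH]; first by rewrite subn0.
  apply: leq_trans IH; case: (leqP n./2 d) => [dn|dn].
    by have -> : n./2 - d.+1 = n./2 - d by lia.
  have -> : n./2 - d = (n./2 - d.+1).+1 by lia.
  by apply: step; lia.
case: (leqP i n./2) => [|hi]; first exact: low.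
case: (leqP i n) => [ni|ni]; last by rewrite bin_small.
by rewrite -bin_sub //; apply: low; lia.
Qed.

Lemma central_bin_gt0 n : 0 < 'C(n, n./2).
Proof. by rewrite bin_gt0; lia. Qed.

(** Used for components with at most five edges whose hull contains an interval of height [d]. *)
Lemma central_bin_drop2 n d a : 1 < d -> 'C(n - d, a) <= 'C(n - 2, n./2 - 1).
Proof.
move=> d2; apply: (@leq_trans 'C(n - 2, a)); first by apply: leq_bin2l; lia.
by have := bin_le_central (n - 2) a; have -> : (n - 2)./2 = n./2 - 1 by lia.
Qed.

(** Put [N = n - 3] and [h = N./2]. By Pascal's rule the right-hand binomial is at least
    ['C(N, h) + 'C(N, h.+1)]. The second term is at least [h / h.+1] times the first, so the sum is
    at least 3/2 of ['C(N, h)], and 5 * 3/2 exceeds 6. *)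
Lemma central_bin_drop3 n d a : 5 <= n -> 2 < d ->
  6 * 'C(n - d, a) <= 5 * 'C(n - 2, n./2 - 1).
Proof.
move=> n5 d3; set N := n - 3; set h := N./2.
have le1 : 'C(n - d, a) <= 'C(N, h).
  apply: (@leq_trans 'C(N, a)); last exact: bin_le_central.
  by apply: leq_bin2l; lia.
have le2 : 'C(N, h.+1) + 'C(N, h) <= 'C(n - 2, n./2 - 1).
  rewrite -binS; have -> : n./2 - 1 = (n - 2)./2 by lia.
  have -> : n - 2 = N.+1 by lia.
  by apply: bin_le_central.
have e := mul_bin_left N h.
have : h * 'C(N, h) <= h.+1 * 'C(N, h.+1) by rewrite e leq_mul2r; apply/orP; right; lia.
have : 1 <= h by lia.
nia.
Qed.

Lemma bin_diag2 n k : 0 < k -> k < n ->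
  n * (n - 1) * 'C(n - 2, k - 1) = k * (n - k) * 'C(n, k).
Proof.
move=> k0 kn; have := mul_bin_diag n k.-1; have := mul_bin_down n.-1 k.-1.
have -> : n.-1.-1 = n - 2 by lia. have -> : n.-1 = n - 1 by lia.
rewrite prednK //; have -> : k.-1 = k - 1 by lia.
have -> : n - 1 - (k - 1) = n - k by lia.
by nia.
Qed.

(** With [k = n./2] the quotient of the two binomials is [n (n - 1) / (k (n - k))], which is at most
    4. *)
Lemma central_bin_le4 n : 2 <= n -> 'C(n, n./2) <= 4 * 'C(n - 2, n./2 - 1).
Proof.
move=> n2; have := @bin_diag2 n n./2; set k := n./2; set c := 'C(_, _); set c' := 'C(_, _).
move=> /(_ ltac:(lia) ltac:(lia)) e.
have h : n * (n - 1) <= 4 * (k * (n - k)).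
  have [->|->] : n = k + k \/ n = k + k + 1 by lia.
    have -> : k + k - k = k by lia.
    by nia.
  have -> : k + k + 1 - k = k + 1 by lia.
  by nia.
have h0 : 0 < n * (n - 1) by nia.
rewrite -(leq_pmul2l h0) mulnCA e.
apply: leq_trans (leq_mul h (leqnn _)) _; by rewrite !mulnA.
Qed.

Lemma central_bin_ge4 n : 2 <= n ->
  4 * (n - 1) * 'C(n - 2, n./2 - 1) <= n * 'C(n, n./2).
Proof.
move=> n2; have := @bin_diag2 n n./2; set k := n./2; set c := 'C(_, _); set c' := 'C(_, _).
move=> /(_ ltac:(lia) ltac:(lia)) e.
have h : 4 * (k * (n - k)) <= n * n.
  have [->|->] : n = k + k \/ n = k + k + 1 by lia.
    have -> : k + k - k = k by lia.
    by nia.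
  have -> : k + k + 1 - k = k + 1 by lia.
  by nia.
have h0 : 0 < n by lia.
rewrite -(leq_pmul2l h0).
have -> : n * (4 * (n - 1) * c) = 4 * (n * (n - 1) * c) by lia.
rewrite e !mulnA -(mulnA 4); exact: (leq_mul h).
Qed.

(** The step from [t] to [t.+1] multiplies by [(n - t) / t.+1]. For [t <= 9] this is at least 2 as
    soon as [n - 9 >= 20], which is where the threshold 29 comes from. *)
Lemma central_bin_double n t : 29 <= n -> t < 10 ->
  2 * 'C(n, t) <= 'C(n, n./2).
Proof.
move=> n29 t10; apply: leq_trans (bin_le_central n t.+1).
have := mul_bin_left n t; nia.
Qed.

Lemma leq_bin_row n m : 0 < m < n -> n <= 'C(n, m).
Proof.
case: n => // n /andP[]; case: m => // m _ mn.
rewrite binS; elim: n m mn => // n IH m mn.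
case: (ltnP m n) => h.
  have h1 := IH _ h; have : 0 < 'C(n.+1, m) by rewrite bin_gt0; lia.
  rewrite binS; lia.
have -> : m = n by lia.
by rewrite binn -bin_sub // subSnn bin1.
Qed.

(** * Initial segments of permutations *)

(* The initial segments of a permutation form a maximal chain of subsets. *)
Definition initial n (s : 'S_n) (A : {set 'I_n}) : bool :=
  [forall x in A, forall y in ~: A, s x < s y].

Lemma initialP n (s : 'S_n) (A : {set 'I_n}) :
  reflect (forall x y, x \in A -> y \notin A -> s x < s y) (initial s A).
Proof.
apply: (iffP forall_inP) => [h x y xA yA|h x xA].
  by have /forall_inP := h x xA; apply; rewrite inE.
by apply/forall_inP => y; rewrite inE; apply: h.
Qed.

Lemma initial0 n (s : 'S_n) : initial s set0.
Proof. by apply/initialP => x y; rewrite inE. Qed.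

Lemma initialT n (s : 'S_n) : initial s setT.
Proof. by apply/initialP => x y _; rewrite inE. Qed.

Lemma initial_total n (s : 'S_n) (A B : {set 'I_n}) :
  initial s A -> initial s B -> (A \subset B) || (B \subset A).
Proof.
move=> /initialP hA /initialP hB; apply/contraT; rewrite negb_or.
move=> /andP[/subsetPn[x xA xB] /subsetPn[y yB yA]].
by have := hA _ _ xA yA; have := hB _ _ yB xB; lia.
Qed.

Lemma subset_cardE (T : finType) (A B : {set T}) :
  (A \subset B) || (B \subset A) -> #|A| = #|B| -> A = B.
Proof.
by case/orP=> h c; apply/eqP; [|rewrite eq_sym]; rewrite eqEcard h c leqnn.
Qed.

(** Relabelling the ground set permutes the maximal chains, so counts of chains are invariant under
    transpositions that fix the sets involved. *)
Lemma initialM n (t s : 'S_n) (A : {set 'I_n}) :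
  initial (t * s)%g A = initial s (t @: A).
Proof.
apply/initialP/initialP => h.
  move=> _ y /imsetP[x xA ->] yA; have := h x ((t^-1)%g y) xA; rewrite !permM permKV; apply.
  by apply: contra yA => yA; apply/imsetP; exists ((t^-1)%g y); rewrite ?permKV.
move=> x y xA yA; rewrite !permM; apply: h; first exact: imset_f.
by rewrite mem_imset //; apply: perm_inj.
Qed.

Lemma card_perm_mull n (t : 'S_n) (P : pred 'S_n) :
  #|[set s | P (t * s)%g]| = #|[set s | P s]|.
Proof.
rewrite -(card_preimset [set s | P s] (mulgI t)).
by apply: eq_card => s; rewrite !inE.
Qed.

Lemma tperm_imset_id (T : finType) (x y : T) (A : {set T}) :
  (x \in A) = (y \in A) -> tperm x y @: A = A.
Proof.
move=> xy; apply/setP => z; rewrite -{1}(tpermK x y z) mem_imset; last exact: perm_inj.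
by case: tpermP => [->|->|//].
Qed.

(** Induction on [#|A :\: B|]: swapping an element of [A :\: B] with one of [B :\: A] brings [A]
    closer to [B] and leaves [f] unchanged. *)
Lemma tperm_invariant_const (T : finType) (f : {set T} -> nat) (Y : {set T}) :
    (forall x y (A : {set T}), x \in Y -> y \in Y -> f (tperm x y @: A) = f A) ->
  forall A B : {set T}, A \subset Y -> B \subset Y -> #|A| = #|B| -> f A = f B.
Proof.
move=> fE A B; move: {2}#|A :\: B| (erefl #|A :\: B|) => d.
elim: d A => [|d IH] A dE AY BY AB.
  move/eqP: dE; rewrite cards_eq0 setD_eq0 => sAB; congr f; apply/eqP.
  by rewrite eqEcard sAB AB leqnn.
have [x] : exists x, x \in A :\: B by apply/card_gt0P; rewrite dE.
rewrite inE => /andP[xB xA].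
have [y] : exists y, y \in B :\: A.
  apply/card_gt0P; have := cardsID B A; have := cardsID A B; rewrite setIC; lia.
rewrite inE => /andP[yA yB].
have xY := subsetP AY x xA; have yY := subsetP BY y yB.
have mem z : (z \in tperm x y @: A) = (tperm x y z \in A).
  by rewrite -{1}(tpermK x y z) mem_imset //; apply: perm_inj.
rewrite -(fE x y A xY yY); apply: IH => //; last 1 first.
- by rewrite card_imset //; apply: perm_inj.
- have -> : (tperm x y @: A) :\: B = (A :\: B) :\ x.
    apply/setP => z; rewrite !inE mem.
    case: tpermP => [->|->|/eqP zx /eqP zy].
    + by rewrite xB eqxx (negbTE yA) andbF.
    + by rewrite yB andbF.
    + by rewrite zx.
  by have := cardsD1 x (A :\: B); rewrite dE !inE xB xA; lia.
- by apply/subsetP => z; rewrite mem; case: tpermP => [->|->|_ _ /(subsetP AY)].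
Qed.

Lemma double_count (S I : finType) (D : {set I}) (Q : I -> S -> bool) :
  \sum_(i in D) #|[set s | Q i s]| = \sum_s #|[set i in D | Q i s]|.
Proof.
transitivity (\sum_(i in D) \sum_(s | Q i s) 1).
  by apply: eq_bigr => i _; rewrite sum1_card; apply: eq_card => s; rewrite !inE.
rewrite (exchange_big_dep predT) //=; apply: eq_bigr => s _.
by rewrite sum1_card; apply: eq_card => i; rewrite !inE.
Qed.

(* For fixed [Z], the events "[Z :|: A] is initial" with [A] ranging over the
   subsets of [Y] of a given size are disjoint and equally likely. *)
Lemma card_initial_pair n (B Z Y A : {set 'I_n}) :
    A \subset Y -> [disjoint Y & Z] -> (Y \subset B) || (Y \subset ~: B) ->
  'C(#|Y|, #|A|) * #|[set s : 'S_n | initial s (Z :|: A) && initial s B]|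
    <= #|[set s : 'S_n | initial s B]|.
Proof.
move=> AY YZ YB; pose f (A : {set 'I_n}) :=
  #|[set s : 'S_n | initial s (Z :|: A) && initial s B]|.
have fE x y (X : {set 'I_n}) : x \in Y -> y \in Y -> f (tperm x y @: X) = f X.
  move=> xY yY; rewrite /f -[RHS](card_perm_mull (tperm x y)).
  (* A transposition inside [Y] fixes [Z], and it fixes [B] because [Y] lies in [B] or in its
     complement. *)
  have zN z : z \in Y -> z \notin Z by move=> zY; rewrite (disjointFr YZ zY).
  have ZE : tperm x y @: Z = Z by apply: tperm_imset_id; rewrite !(negbTE (zN _ _)).
  have BE : tperm x y @: B = B.
    apply: tperm_imset_id; case/orP: YB => /subsetP YB; first by rewrite !YB.
    by have := YB _ xY; have := YB _ yY; rewrite !inE => /negbTE -> /negbTE ->.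
  by apply: eq_card => s; rewrite !inE !initialM imsetU ZE BE.
pose D := [set X : {set 'I_n} | X \subset Y & #|X| == #|A|].
have -> : 'C(#|Y|, #|A|) * f A = \sum_(X in D) f X.
  rewrite -cards_draws -sum_nat_const; apply: eq_bigr => X; rewrite inE => /andP[XY /eqP XA].
  by apply: (tperm_invariant_const fE).
rewrite double_count -[X in _ <= X]sum1_card [X in _ <= X]big_mkcond leq_sum // => s _.
case: ifP; rewrite inE => sB; last first.
  by rewrite leqn0 cards_eq0; apply/eqP/setP => X; rewrite !inE sB !andbF.
apply/card_le1_eqP => X1 X2; rewrite !inE => /andP[/andP[X1Y /eqP c1] /andP[i1 _]].
move=> /andP[/andP[X2Y /eqP c2] /andP[i2 _]].
have cU (X : {set 'I_n}) : X \subset Y -> #|Z :|: X| = #|Z| + #|X|.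
  move=> XY; rewrite cardsU; have -> : Z :&: X = set0; last by rewrite cards0 subn0.
  by apply/eqP; rewrite setIC setI_eq0; apply: disjointWl YZ.
have e : Z :|: X1 = Z :|: X2.
  by apply: subset_cardE; [exact: initial_total i1 i2|rewrite !cU // c1 c2].
have sect (X : {set 'I_n}) : X \subset Y -> X = (Z :|: X) :\: Z.
  move=> XY; rewrite setDUl setDv set0U; apply/esym/setDidPl.
  by apply: disjointWl YZ.
by rewrite (sect _ X1Y) (sect _ X2Y) e.
Qed.

Lemma setU_setD (T : finType) (A B : {set T}) : A \subset B -> A :|: (B :\: A) = B.
Proof. by move=> AB; rewrite -{1}(setIidPr AB) setID. Qed.

Lemma card_initial_sub n (A B : {set 'I_n}) : A \subset B ->
  'C(#|B|, #|A|) * #|[set s : 'S_n | initial s A && initial s B]|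
    <= #|[set s : 'S_n | initial s B]|.
Proof.
move=> AB; have := @card_initial_pair n B set0 B A AB.
by rewrite set0U; apply; rewrite ?subxx // -setI_eq0 setI0.
Qed.

Lemma card_initial_sup n (A B : {set 'I_n}) : B \subset A ->
  'C(n - #|B|, #|A| - #|B|) * #|[set s : 'S_n | initial s A && initial s B]|
    <= #|[set s : 'S_n | initial s B]|.
Proof.
move=> BA; have := @card_initial_pair n B B (~: B) (A :\: B).
rewrite (setU_setD BA) cardsCs setCK card_ord cardsDS //; apply.
- by rewrite setDE subsetIr.
- by rewrite -setI_eq0 setIC setICr.
- by rewrite subxx orbT.
Qed.

(** * Chains meeting an interval *)

Lemma nat_ivt (g : nat -> nat) m a :
  g 0 = 0 -> (forall i, g i.+1 <= (g i).+1) -> a <= g m -> exists i, g i = a.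
Proof.
move=> g0 gS; elim: m => [|m IH] h; first by exists 0; lia.
case: (leqP a (g m)) => [/IH //|h1]; exists m.+1; have := gS m; lia.
Qed.

(** Along the chain of [s] the part outside [X] grows by at most one element at a time, from 0 to
    [n - #|X|], so it takes every size in between. *)
Lemma exists_prefix n (s : 'S_n) (X : {set 'I_n}) a : a <= n - #|X| ->
  exists A S : {set 'I_n}, [/\ initial s S, S :\: X = A & #|A| = a].
Proof.
move=> ha; pose pre i := [set x | s x < i].
have [|i||i iE] := @nat_ivt (fun i => #|pre i :\: X|) n a.
- by apply/eqP; rewrite cards_eq0; apply/eqP/setP => x; rewrite !inE ltn0 andbF.
- have sub : pre i.+1 :\: X \subset (pre i :\: X) :|: [set x | s x == i :> nat].
    by apply/subsetP => x; rewrite !inE ltnS leq_eqVlt => /andP[-> /orP[->|->]] //=; rewrite orbT.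
  apply: leq_trans (subset_leq_card sub) _; rewrite cardsU.
  have : #|[set x | s x == i :> nat]| <= 1.
    apply/card_le1_eqP => x y; rewrite !inE => /eqP h /eqP h'.
    by apply: (@perm_inj _ s); apply: ord_inj; rewrite h h'.
  lia.
- have -> : pre n :\: X = ~: X by apply/setP => x; rewrite !inE ltn_ord andbT.
  by rewrite cardsCs setCK card_ord.
- exists (pre i :\: X), (pre i); split=> //.
  by apply/initialP => x y; rewrite !inE; lia.
Qed.

(** The intervals [[B, B :|: X]] with [B] disjoint from [X] and [#|B| = #|A|] are met by equally
    many chains, by symmetry outside [X]. Every chain meets at least one of them, and their number
    is the binomial coefficient. *)
Lemma card_meets_interval n (A D : {set 'I_n}) : A \subset D ->
  n`! <= 'C(n - #|D :\: A|, #|A|) *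
    #|[set s : 'S_n | [exists S : {set 'I_n}, [&& A \subset S, S \subset D & initial s S]]]|.
Proof.
move=> AD; set X := D :\: A; pose f (B : {set 'I_n}) :=
  #|[set s : 'S_n | [exists S : {set 'I_n}, [&& B \subset S, S \subset B :|: X & initial s S]]]|.
have -> : D = A :|: X by rewrite /X (setU_setD AD).
rewrite -/(f A).
have fE x y (B : {set 'I_n}) : x \in ~: X -> y \in ~: X -> f (tperm x y @: B) = f B.
  rewrite !in_setC => xX yX; rewrite /f -[RHS](card_perm_mull (tperm x y)).
  have XE : tperm x y @: X = X by apply: tperm_imset_id; rewrite (negbTE xX) (negbTE yX).
  have tK (S : {set 'I_n}) : tperm x y @: (tperm x y @: S) = S.
    by rewrite -imset_comp (eq_imset _ (g := id)) ?imset_id // => z /=; rewrite tpermK.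
  apply: eq_card => s; rewrite !inE; apply/existsP/existsP => -[S /and3P[h1 h2 h3]];
    exists (tperm x y @: S).
    by have := imsetS (tperm x y) h1; have := imsetS (tperm x y) h2; rewrite imsetU XE tK initialM tK h3 => -> ->.
  by have := imsetS (tperm x y) h1; have := imsetS (tperm x y) h2; rewrite imsetU XE -initialM h3 => -> ->.
have cA : A \subset ~: X by rewrite /X; apply/subsetP => z zA; rewrite !inE zA.
have cX : #|~: X| = n - #|X| by rewrite cardsCs setCK card_ord.
pose E := [set B : {set 'I_n} | B \subset ~: X & #|B| == #|A|].
have -> : 'C(n - #|X|, #|A|) * f A = \sum_(B in E) f B.
  rewrite -cX -cards_draws -sum_nat_const; apply: eq_bigr => B; rewrite inE => /andP[BY /eqP BA].
  by apply: (tperm_invariant_const fE).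
rewrite double_count -card_Sn -sum1_card; apply: leq_sum => s _.
(* The prefix [S] of [s] with exactly [#|A|] elements outside [X] lies in the interval above
   [B = S :\: X]. *)
have := subset_leq_card cA; rewrite cX => /(exists_prefix s)[B [S [sS SB cB]]].
apply/card_gt0P; exists B; rewrite !inE cB eqxx andbT -SB; apply/andP; split.
  by rewrite setDE subsetIr.
apply/existsP; exists S; rewrite sS andbT setDE subsetIl /=.
by apply/subsetP => z zS; rewrite in_setU in_setI in_setC zS; case: (z \in X).
Qed.

Lemma card_initial_ge n (A : {set 'I_n}) :
  n`! <= 'C(n, #|A|) * #|[set s : 'S_n | initial s A]|.
Proof.
have := card_meets_interval (subxx A); rewrite setDv cards0 subn0.
move/leq_trans; apply; rewrite leq_mul2l; apply/orP; right; apply: subset_leq_card.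
apply/subsetP => s; rewrite !inE => /existsP[S /and3P[h1 h2 h3]].
by have -> : A = S by apply/eqP; rewrite eqEsubset h1.
Qed.

(** * Graphs without a path on five vertices *)

Definition no_path5 (T : finType) (e : rel T) : Prop :=
  forall a b c d x, e a b -> e b c -> e c d -> e d x -> uniq [:: a; b; c; d; x] -> False.

Definition nonleaf (T : finType) (e : rel T) (x : T) : bool := 1 < #|[set y | e x y]|.

Definition heavy (T : finType) (e : rel T) (x : T) : bool :=
  2 < #|[set y | e x y && nonleaf e y]|.

Lemma three_of_card (T : finType) (A : {set T}) : 2 < #|A| ->
  exists x y z, [/\ x \in A, y \in A, z \in A & [/\ x != y, x != z & y != z]].
Proof.
move=> h; have /card_gt0P[x xA] : 0 < #|A| by lia.
have /card_gt0P[y] : 0 < #|A :\ x| by have := cardsD1 x A; rewrite xA; lia.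
rewrite !inE => /andP[yx yA].
have /card_gt0P[z] : 0 < #|A :\ x :\ y|.
  by have := cardsD1 x A; have := cardsD1 y (A :\ x); rewrite !inE xA yA yx /=; lia.
rewrite !inE => /and3P[zy zx zA]; exists x, y, z.
by rewrite xA yA zA ![x == _]eq_sym yx zx [y == _]eq_sym zy.
Qed.

Section HeavyVertex.
Variables (T : finType) (e : rel T).
Hypotheses (esym : symmetric e) (eirr : irreflexive e) (p5 : no_path5 e).

Let eneq a b : e a b -> a <> b.
Proof. by move=> eab ab; rewrite ab eirr in eab. Qed.

Let p5_neq a b c d x : e a b -> e b c -> e c d -> e d x ->
  a <> c -> a <> d -> a <> x -> b <> d -> b <> x -> c <> x -> False.
Proof.
move=> ab bc cd dx /eqP h1 /eqP h2 /eqP h3 /eqP h4 /eqP h5 /eqP h6.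
have [/eqP h7 /eqP h8] := (eneq ab, eneq bc); have [/eqP h9 /eqP h10] := (eneq cd, eneq dx).
apply: (p5 ab bc cd dx); rewrite /= !inE !negb_or.
by rewrite h1 h2 h3 h4 h5 h6 h7 h8 h9 h10.
Qed.

Let nonleaf_other b x : e b x -> nonleaf e x -> exists2 w, e x w & w <> b.
Proof.
rewrite esym => xb h; have /card_gt0P[w] : 0 < #|[set y | e x y] :\ b|.
  by have := cardsD1 b [set y | e x y]; rewrite inE xb; move: h; rewrite /nonleaf; lia.
by rewrite !inE => /andP[/eqP wb xw]; exists w.
Qed.

Let nbr_closed b x y z w : e b x -> e b y -> e b z ->
  nonleaf e y -> x <> y -> x <> z -> y <> z ->
  e x w -> [\/ w = b, w = y | w = z].
Proof.
move=> bx ey bz ny xy xz yz xw.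
have [->|/eqP wb] := eqVneq w b; first by constructor 1.
have [->|/eqP wy] := eqVneq w y; first by constructor 2.
have [->|/eqP wz] := eqVneq w z; first by constructor 3.
(* If [w] lay outside [b], [y], [z], there would be a path on five vertices: [x w y b z] if [q = w],
   [w x y b z] if [q = x], and [w x b y q] otherwise. *)
have [q yq qb] := nonleaf_other ey ny.
have := (eneq bx, eneq ey, eneq bz); move=> [[n1 n2] n3].
have [qw|/eqP qw] := eqVneq q w.
  subst q; have wy' : e w y by rewrite esym.
  have yb : e y b by rewrite esym.
  by case: (p5_neq xw wy' yb bz); congruence.
have wx : e w x by rewrite esym.
have [qx|/eqP qx] := eqVneq q x.
  subst q; have xy' : e x y by rewrite esym.
  have yb : e y b by rewrite esym.
  by case: (p5_neq wx xy' yb bz); congruence.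
have xb : e x b by rewrite esym.
by case: (p5_neq wx xb ey yq); congruence.
Qed.

(** Each of the three nonleaf neighbours of [b] has a further neighbour, which can only be another
    of the three. Hence these three span at least two edges, and any edge leaving the four vertices
    would complete a path on five vertices. *)
Lemma heavy_component b : heavy e b -> exists x y z,
  [/\ uniq [:: b; x; y; z], [/\ e b x, e b y & e b z], e x y, e y z &
      forall u, connect e b u -> u \in [:: b; x; y; z]].
Proof.
move=> /three_of_card[x [y [z []]]]; rewrite !inE.
move=> /andP[bx nx] /andP[ey ny] /andP[bz nz] [/eqP xy /eqP xz /eqP yz].
have main x' y' z' : e b x' -> e b y' -> e b z' ->
    nonleaf e x' -> nonleaf e y' -> nonleaf e z' ->
    x' <> y' -> x' <> z' -> y' <> z' -> e x' y' -> e y' z' ->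
    [/\ uniq [:: b; x'; y'; z'], [/\ e b x', e b y' & e b z'], e x' y', e y' z' &
        forall u, connect e b u -> u \in [:: b; x'; y'; z']].
  move=> {x y z xy xz yz bx ey bz nx ny nz} bx ey bz nx ny nz xy xz yz exy eyz; split=> //.
    have := (eneq bx, eneq ey, eneq bz) => -[[/eqP n1 /eqP n2] /eqP n3].
    by rewrite /= !inE !negb_or n1 n2 n3 (introN eqP xy) (introN eqP xz) (introN eqP yz).
  have cl u v : u \in [:: b; x'; y'; z'] -> e u v -> v \in [:: b; x'; y'; z'].
    rewrite !inE => /or4P[] /eqP -> uv; apply/or4P.
    (* A further neighbour [v] of [b] would give the path [x' y' z' b v]. *)
    - have [vx|/eqP vx] := eqVneq v x'; first by constructor 2.
      have [vy|/eqP vy] := eqVneq v y'; first by constructor 3.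
      have [vz|/eqP vz] := eqVneq v z'; first by constructor 4.
      have zb : e z' b by rewrite esym.
      have := (eneq bx, eneq ey, eneq bz) => -[[n1 n2] n3].
      by case: (p5_neq exy eyz zb uv); congruence.
    - by case: (nbr_closed bx ey bz ny xy xz yz uv) => ->; rewrite eqxx; constructor.
    - have := nbr_closed ey bx bz nx (nesym xy) yz xz uv.
      by case=> ->; rewrite eqxx; constructor.
    - have := nbr_closed bz bx ey nx (nesym xz) (nesym yz) xy uv.
      by case=> ->; rewrite eqxx; constructor.
  move=> u /connectP[p]; have : b \in [:: b; x'; y'; z'] by rewrite inE eqxx.
  elim: p {1 3 4}b => [|v p IH] a ain /=; first by move=> _ ->.
  by move=> /andP[av pv] ul; apply: IH pv ul; apply: cl av.
have [[[wx xw wxb] [wy yw wyb]] [wz zw wzb]] :=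
  (nonleaf_other bx nx, nonleaf_other ey ny, nonleaf_other bz nz).
have hx : e x y \/ e x z by have := (nbr_closed bx ey bz ny xy xz yz xw); case=> E; rewrite E // in xw; auto.
have hy : e y x \/ e y z.
  by have := (nbr_closed ey bx bz nx (nesym xy) yz xz yw); case=> E; rewrite E // in yw; auto.
have hz : e z x \/ e z y.
  by have := (nbr_closed bz bx ey nx (nesym xz) (nesym yz) xy zw); case=> E; rewrite E // in zw; auto.
have [exy|nxy] := boolP (e x y).
  have [eyz|nyz] := boolP (e y z); first by exists x, y, z; apply: main.
  have ezx : e z x by case: hz => // h; rewrite esym (negbTE nyz) in h.
  by exists z, x, y; apply: main => //; apply: nesym.
have exz : e x z by case: hx => // h; rewrite h in nxy.
have ezy : e z y by rewrite esym; case: hy => // h; rewrite esym (negbTE nxy) in h.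
by exists x, z, y; apply: main => //; apply: nesym.
Qed.

(* Each edge [a b] carries total weight at least 2, split between its ends;
   [edge_weight a b] is the part charged to [b]. *)
Definition edge_weight (a b : T) : nat :=
  if nonleaf e b then nonleaf e a : nat else 2.

Lemma edge_weight_ge2 a b : 2 <= edge_weight a b + edge_weight b a.
Proof. by rewrite /edge_weight; case: (nonleaf e a); case: (nonleaf e b). Qed.

(** A nonleaf that is not heavy is charged 1 by each of at most two nonleaf neighbours; a vertex
    with at most one neighbour is charged 2 at most once. *)
Lemma sum_edge_weight b : ~~ heavy e b -> \sum_(a | e a b) edge_weight a b <= 2.
Proof.
rewrite -leqNgt /edge_weight => hb; case nb: (nonleaf e b).
  apply: leq_trans hb; rewrite -sum1_card big_mkcond [X in _ <= X]big_mkcond /=.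
  apply: leq_sum => a _; rewrite inE [e b a]esym; by case: (e a b); case: (nonleaf e a).
rewrite sum_nat_cond_const; move/negbT: nb; rewrite /nonleaf -leqNgt.
have -> : [set a | e a b] = [set y | e b y] by apply/setP => a; rewrite !inE esym.
lia.
Qed.

End HeavyVertex.

(** * Path posets and the comparability graph *)

(* The poset on [0, ..., k-1] generated by the relations [m < m+1] (when [u m])
   and [m+1 < m] (otherwise). *)
Definition fence (k : nat) (u : nat -> bool) : Type := 'I_k.

HB.instance Definition _ (k : nat) (u : nat -> bool) :=
  Finite.copy (fence k u) 'I_k.

Definition fence_le (k : nat) (u : nat -> bool) (i j : fence k u) : bool :=
  let i' : nat := (i : 'I_k) in let j' : nat := (j : 'I_k) in
  (i' <= j') && all u (iota i' (j' - i')) ||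
  (j' <= i') && all (predC u) (iota j' (i' - j')).

Lemma fence_leP k u (i j : fence k u) :
  reflect (((i : 'I_k) <= (j : 'I_k) /\ forall m, (i : 'I_k) <= m < (j : 'I_k) -> u m) \/
           ((j : 'I_k) <= (i : 'I_k) /\ forall m, (j : 'I_k) <= m < (i : 'I_k) -> ~~ u m))
          (fence_le i j).
Proof.
have aux (v : pred nat) a b : a <= b ->
    reflect (forall m, a <= m < b -> v m) (all v (iota a (b - a))).
  move=> ab; apply: (iffP allP) => h m; last first.
    by rewrite mem_iota => hm; apply: h; lia.
  by move=> hm; apply: h; rewrite mem_iota; lia.
apply: (iffP orP) => -[].
- by case/andP=> ij /(aux _ _ _ ij); left.
- by case/andP=> ij /(aux _ _ _ ij); right.
- by case=> ij /(aux _ _ _ ij) h; left; rewrite ij.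
- by case=> ij h; right; rewrite ij; apply/(aux _ _ _ ij).
Qed.

Lemma fence_le_refl k u : reflexive (@fence_le k u).
Proof. by move=> i; rewrite /fence_le leqnn subnn. Qed.

Lemma fence_le_anti k u : antisymmetric (@fence_le k u).
Proof.
move=> i j /andP[/fence_leP h1 /fence_leP h2]; apply: ord_inj.
case: h1 h2 => -[ij h1] [[ji h2]|[ji h2]]; try lia.
- case: (ltngtP (i : 'I_k) (j : 'I_k)) => // lt; last lia.
  by have := h1 (i : 'I_k); rewrite (negbTE (h2 _ _)); lia.
- case: (ltngtP (i : 'I_k) (j : 'I_k)) => // lt; first lia.
  by have := h2 (j : 'I_k); rewrite (negbTE (h1 _ _)); lia.
Qed.

Lemma fence_le_trans k u : transitive (@fence_le k u).
Proof.
move=> j i l /fence_leP h1 /fence_leP h2; apply/fence_leP.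
move: (nat_of_ord (i : 'I_k)) (nat_of_ord (j : 'I_k)) (nat_of_ord (l : 'I_k)) h1 h2.
move=> {i j l} i j l [[ij h1]|[ij h1]] [[jl h2]|[jl h2]].
- left; split; first lia.
  by move=> m hm; case: (ltnP m j) => ?; [apply: h1|apply: h2]; lia.
(* Two runs of opposite direction that meet at [j] would share the step next to [j], so one of them
   is trivial. *)
- case: (ltnP i j) => hij; last by right; split=> [|m hm]; [lia|apply: h2; lia].
  case: (ltnP l j) => hlj; last by left; split=> [|m hm]; [lia|apply: h1; lia].
  by have := h1 j.-1; rewrite (negbTE (h2 _ _)); lia.
- case: (ltnP j i) => hij; last by left; split=> [|m hm]; [lia|apply: h2; lia].
  case: (ltnP j l) => hlj; last by right; split=> [|m hm]; [lia|apply: h1; lia].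
  by have := h2 j; rewrite (negbTE (h1 _ _)); lia.
- right; split; first lia.
  by move=> m hm; case: (ltnP m j) => ?; [apply: h2|apply: h1]; lia.
Qed.

HB.instance Definition _ (k : nat) (u : nat -> bool) :=
  Order.Le_isPOrder.Build (Order.Disp tt tt) (fence k u)
    (@fence_le_refl k u) (@fence_le_anti k u) (@fence_le_trans k u).

(** Comparable elements are joined by a run of steps in one direction, and the inner elements of the
    run lie strictly between them. So the cover relations are the runs of length one. *)
Lemma fence_path k u : path_poset k (fence k u).
Proof.
exists (id : 'I_k -> fence k u); split; first by exists id.
have ltE (i j : fence k u) : (i < j)%O = (i != j) && fence_le i j.
  by rewrite Order.POrderTheory.lt_neqAle.
have cov (i j : 'I_k) : @covers _ (fence k u) i j =
    (i.+1 == j) && u i || (j.+1 == i) && ~~ u j.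
  apply/andP/orP => [[]|].
    rewrite ltE => /andP[ij /fence_leP h] /existsPn nz.
    have ij' : (i != j :> nat) by apply: contra ij => /eqP/ord_inj->.
    case: h => -[le h].
      left; case: (ltngtP i.+1 j) => [lt|?|e]; [|lia|by apply: h; lia].
      have lt' : i.+1 < k by have := ltn_ord j; lia.
      have := nz (Ordinal lt' : fence k u); rewrite !ltE; case/negP.
      rewrite -!val_eqE /=; apply/andP; split; (apply/andP; split; first lia);
        by apply/fence_leP; left => /=; split=> [|m hm]; [lia|apply: h; lia].
    right; case: (ltngtP j.+1 i) => [lt|?|e]; [|lia|by apply: h; lia].
    have lt' : j.+1 < k by have := ltn_ord i; lia.
    have := nz (Ordinal lt' : fence k u); rewrite !ltE; case/negP.
    rewrite -!val_eqE /=; apply/andP; split; (apply/andP; split; first lia);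
      by apply/fence_leP; right => /=; split=> [|m hm]; [lia|apply: h; lia].
  move=> h; have [le d1] : fence_le (i : fence k u) j /\ (i.+1 == j) || (j.+1 == i).
    case: h => /andP[/eqP e um]; split; try lia; apply/fence_leP; [left|right].
      by split=> [|m hm]; [lia|have -> : m = i by lia].
    by split=> [|m hm]; [lia|have -> : m = j by lia].
  split; first by rewrite ltE le andbT; apply/eqP => /(congr1 (@nat_of_ord k)); lia.
  apply/existsPn => z; rewrite !ltE; apply/negP => /andP[/andP[iz lz] /andP[zj lj]].
  have iz' : (i != (z : 'I_k) :> nat) by apply: contra iz => /eqP/ord_inj->.
  have zj' : ((z : 'I_k) != j :> nat) by apply: contra zj => /eqP/ord_inj->.
  move: lz lj => /fence_leP + /fence_leP.
  move: (nat_of_ord (z : 'I_k)) iz' zj' => m iz' zj' lz lj.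
  case: lz lj => -[l1 h1] [[l2 h2]|[l2 h2]]; try lia.
  - by have := h1 m.-1; rewrite (negbTE (h2 _ _)); lia.
  - by have := h2 m; rewrite (negbTE (h1 _ _)); lia.
move=> i j; rewrite /hasse_adj !cov; case: (u i); case: (u j); rewrite /=; lia.
Qed.

(** Let [u] record the direction of each inclusion along the path. Inclusions along a run compose,
    so [f] embeds the fence of [u] weakly; further comparabilities among the sets do no harm. *)
Lemma path_free_no_path (k n : nat) (F : {set {set 'I_n}}) (f : nat -> {set 'I_n}) :
    path_free k F -> (forall i, i < k -> f i \in F) ->
    {in gtn k &, injective f} ->
    (forall i, i.+1 < k -> (f i \subset f i.+1) || (f i.+1 \subset f i)) ->
  False.
Proof.
move=> free fF finj fadj; pose u m := f m \subset f m.+1.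
apply: (free _ _ (fence_path k u)); exists (fun i : fence k u => f (i : 'I_k)); split.
- by move=> i j /finj h; apply: ord_inj; apply: h; rewrite inE.
- by move=> i; apply: fF.
have chain a b : a <= b -> b < k -> (forall m, a <= m < b -> u m) -> f a \subset f b.
  elim: b => [|b IH] ab bk h; first by have -> : a = 0 by lia.
  case: (ltngtP a b.+1) ab => // [ab _|->//].
  apply: (@subset_trans _ _ (mem (f b))); last by apply: h; lia.
  by apply: IH; [lia|lia|move=> m hm; apply: h; lia].
have dchain a b : a <= b -> b < k -> (forall m, a <= m < b -> ~~ u m) -> f b \subset f a.
  elim: b => [|b IH] ab bk h; first by have -> : a = 0 by lia.
  case: (ltngtP a b.+1) ab => // [ab _|->//].
  apply: (@subset_trans _ _ (mem (f b))).
    have /negbTE nub : ~~ u b by apply: h; lia.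
    by have := fadj b bk; rewrite -/(u b) nub.
  by apply: IH; [lia|lia|move=> m hm; apply: h; lia].
by move=> i j /fence_leP[] [le h]; [apply: chain|apply: dchain].
Qed.

(** The graph lives on all subsets of the ground set; those outside [F] are isolated vertices. *)
Definition comparability n (F : {set {set 'I_n}}) : rel {set 'I_n} :=
  fun A B => [&& A \in F, B \in F, A != B & (A \subset B) || (B \subset A)].

Lemma comparability_sym n (F : {set {set 'I_n}}) : symmetric (comparability F).
Proof.
move=> A B; rewrite /comparability [A == B]eq_sym [_ || (B \subset A)]orbC.
by case: (A \in F); case: (B \in F).
Qed.

Lemma comparability_irr n (F : {set {set 'I_n}}) : irreflexive (comparability F).
Proof. by move=> A; rewrite /comparability eqxx !andbF. Qed.

Lemma path_free_no_path5 n (F : {set {set 'I_n}}) :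
  path_free 5 F -> no_path5 (comparability F).
Proof.
move=> free A B C D E /and4P[AF BF _ AB] /and4P[_ CF _ BC] /and4P[_ DF _ CD] /and4P[_ EF _ DE] us.
apply: (@path_free_no_path 5 n F (nth set0 [:: A; B; C; D; E]) free).
- by do 5?[case=> //].
- by move=> i j; rewrite !inE => i5 j5 /eqP; rewrite nth_uniq // => /eqP.
- by do 5?[case=> //].
Qed.

(** * Upper bound *)

(** The members of a chain have distinct sizes between those of its least and greatest member. This
    provides the interval of height 2 or 3 in a component with a heavy vertex. *)
Lemma chain_spread (T : finType) (s : seq {set T}) :
    0 < size s -> uniq s -> {in s &, forall A B : {set T}, (A \subset B) || (B \subset A)} ->
  exists A D : {set T}, [/\ A \in s, D \in s, A \subset D & size s <= #|D :\: A|.+1].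
Proof.
move=> s1 us ch; have [A0 s0] : exists A0, A0 \in s.
  by case: s s1 {us ch} => // A s _; exists A; rewrite inE eqxx.
case: (@arg_minnP _ A0 (mem s) (fun A => #|A|) s0) => A /= As Amin.
case: (@arg_maxnP _ A0 (mem s) (fun A => #|A|) s0) => D /= Ds Dmax.
have AD : A \subset D.
  case/orP: (ch _ _ As Ds) => // DA.
  by rewrite (@subset_cardE _ A D) ?DA ?orbT //; have := Amin _ Ds; have := subset_leq_card DA; lia.
exists A, D; split=> //; rewrite cardsDS // -(size_map (fun A : {set T} => #|A|)).
rewrite -[leqRHS](size_iota #|A|); apply: uniq_leq_size.
  rewrite map_inj_in_uniq // => X Y Xs Ys; exact: subset_cardE (ch _ _ Xs Ys).
move=> _ /mapP[X Xs ->]; rewrite mem_iota; have := Amin _ Xs; have := Dmax _ Xs; rewrite /geq /=; lia.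
Qed.

(** Counts copies of the 2-chain in a component, and also in the trace of a component on one maximal
    chain. *)
Definition proper_pairs (T : finType) (M : {set {set T}}) : {set {set T} * {set T}} :=
  [set p | [&& p.1 \in M, p.2 \in M & p.1 \proper p.2]].

Lemma card_proper_pairs (T : finType) (M : {set {set T}}) :
  #|proper_pairs M| = \sum_(B in M) \sum_(A in M) (A \proper B).
Proof.
rewrite exchange_big pair_big_dep /= -sum1_card big_mkcond [RHS]big_mkcond /=.
apply: eq_bigr => -[A B] _; rewrite inE /=.
by case: (A \in M); case: (B \in M); case: (A \proper B).
Qed.

(** Pointwise form of Bonferroni's inequality: the least member of [M] already forms a pair with
    each of the others. *)
Lemma chain_card_le (T : finType) (M : {set {set T}}) :
    {in M &, forall A B : {set T}, (A \subset B) || (B \subset A)} ->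
  #|M| <= (M != set0) + #|proper_pairs M|.
Proof.
move=> ch; have [->|[A0 A0M]] := set_0Vmem M; first by rewrite cards0.
have -> : M != set0 by apply/set0Pn; exists A0.
case: (@arg_minnP _ A0 (mem M) (fun A => #|A|) A0M) => A /= AM Amin.
rewrite (cardsD1 A) AM leq_add2l -(card_imset (mem (M :\ A)) (f := pair A)); last by move=> ? ? [].
apply: subset_leq_card; apply/subsetP => _ /imsetP[B + ->]; rewrite !inE /= => /andP[BA BM].
rewrite AM BM properEneq eq_sym BA /=; case/orP: (ch _ _ AM BM) => // sBA.
by rewrite (@subset_cardE _ A B) ?sBA ?orbT //; have := Amin _ BM; have := subset_leq_card sBA; lia.
Qed.

(** The double sum meets every edge inside [M] in both orientations, and these together weigh at
    least 2. *)
Lemma proper_pairs_le_weight n (F M : {set {set 'I_n}}) : M \subset F ->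
  2 * #|proper_pairs M| <=
    \sum_(B in M) \sum_(A in M | comparability F A B) edge_weight (comparability F) A B.
Proof.
move=> MF; set w := edge_weight _.
have -> : \sum_(B in M) \sum_(A in M | comparability F A B) w A B =
    \sum_(B in M) \sum_(A in M) (A \proper B) * w A B +
    \sum_(B in M) \sum_(A in M) (B \proper A) * w A B.
  rewrite -big_split /=; apply: eq_bigr => B BM; rewrite -big_split /= big_mkcondr /=.
  apply: eq_bigr => A AM; rewrite /comparability (subsetP MF _ AM) (subsetP MF _ BM) /= !properEneq [B == A]eq_sym.
  have [->|AB] := eqVneq A B; first by rewrite mul0n.
  case: (boolP (A \subset B)) => sAB; case: (boolP (B \subset A)) => sBA; rewrite /= ?mul0n ?mul1n ?addn0 //.
  by rewrite eqEsubset sAB sBA in AB.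
rewrite [X in _ + X]exchange_big /= -big_split /=.
rewrite card_proper_pairs big_distrr /=; apply: leq_sum => B _.
rewrite big_distrr /= -big_split /=; apply: leq_sum => A _.
by rewrite -mulnDr mulnC leq_mul2l edge_weight_ge2 orbT.
Qed.

(** * Chains meeting a component without heavy vertices *)

(** Given that [B] is initial, [A] is initial with probability at most [1 / m]. If [#|B|] is at
    least 10 away from 0 and [n], then [m >= 10] and 9/10 of the chains through [B] avoid [A].
    Otherwise [m >= 2] leaves only half of them, but [B] is hit at least twice as often as a middle
    set. *)
Lemma card_initial_pair_le n (A B : {set 'I_n}) : 29 <= n ->
    A != B -> (A \subset B) || (B \subset A) ->
    A != set0 -> A != setT -> B != set0 -> B != setT ->
  10 * 'C(n, n./2) * #|[set s : 'S_n | initial s A && initial s B]| + 9 * n`!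
    <= 10 * 'C(n, n./2) * #|[set s : 'S_n | initial s B]|.
Proof.
move=> n29 AB cAB; rewrite -!card_gt0 -!properT => A0 AT B0 BT.
have := proper_card AT; have := proper_card BT; rewrite !cardsT card_ord => Bn An.
have hB := card_initial_ge B; move: (bin_le_central n #|B|) => hC.
set c := #|[set s | initial s B]| in hB *; set d := #|[set s | _ && _]|.
have [m [m2 mt md]] : exists m, [/\ 2 <= m, minn #|B| (n - #|B|) <= m & m * d <= c].
  case/orP: (cAB) => sAB.
    have ab : #|A| < #|B| by apply: proper_card; rewrite properEneq AB.
    exists 'C(#|B|, #|A|); have := card_initial_sub sAB; rewrite -/c -/d => ->.
    by have := @leq_bin_row #|B| #|A|; split; lia.
  have ab : #|B| < #|A| by apply: proper_card; rewrite properEneq eq_sym AB.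
  exists 'C(n - #|B|, #|A| - #|B|); have := card_initial_sup sAB; rewrite -/c -/d => ->.
  by have := @leq_bin_row (n - #|B|) (#|A| - #|B|); split; lia.
set C := 'C(n, n./2) in hC *; move: (n`!) hB => N hB.
case: (ltnP (minn #|B| (n - #|B|)) 10) => t10; last by nia.
have h2 : 2 * 'C(n, #|B|) <= C.
  case: (leqP #|B| (n - #|B|)) t10 => h t10; first by apply: central_bin_double; lia.
  by rewrite -bin_sub; [apply: central_bin_double; lia|lia].
have : 2 * d <= c by nia.
nia.
Qed.

Lemma card_light_le n (F K : {set {set 'I_n}}) : 29 <= n -> K \subset F ->
    set0 \notin K -> setT \notin K ->
    {in K, forall B, ~~ heavy (comparability F) B} ->
  9 * n`! * #|K| <=
    10 * 'C(n, n./2) * #|[set s : 'S_n | [exists B in K, initial s B]]|.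
Proof.
move=> n29 KF K0 KT light; set e := comparability F; pose w := edge_weight e.
pose c (B : {set 'I_n}) := #|[set s : 'S_n | initial s B]|.
pose c2 (A B : {set 'I_n}) := #|[set s : 'S_n | initial s A && initial s B]|.
set H := [set s | _]; set C := 10 * 'C(n, n./2).
have bonf : 2 * \sum_(B in K) c B <=
    2 * #|H| + \sum_(B in K) \sum_(A in K | e A B) w A B * c2 A B.
  rewrite double_count.
  have -> : \sum_(B in K) \sum_(A in K | e A B) w A B * c2 A B =
      \sum_(s : 'S_n) \sum_(B in K) \sum_(A in K | e A B) w A B * (initial s A && initial s B).
    rewrite exchange_big; apply: eq_bigr => B _; rewrite exchange_big; apply: eq_bigr => A _.
    rewrite -big_distrr /=; congr (_ * _); rewrite /c2 -sum1_card big_mkcond /=.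
    by apply: eq_bigr => s _; rewrite inE; case: (_ && _).
  rewrite -[#|H|]sum1_card [X in 2 * X + _]big_mkcond !big_distrr -big_split /=.
  (* The inequality is proved for each [s] separately, on the trace [M] of [K] on its chain. *)
  apply: leq_sum => s _; set M := [set i in K | initial s i].
  have MK : M \subset K by apply/subsetP => X; rewrite inE => /andP[].
  have ch : {in M &, forall A B : {set 'I_n}, (A \subset B) || (B \subset A)}.
    move=> A B; rewrite !inE => /andP[_ hA] /andP[_ hB]; exact: initial_total hA hB.
  have -> : \sum_(B in K) \sum_(A in K | e A B) w A B * (initial s A && initial s B) =
      \sum_(B in M) \sum_(A in M | e A B) w A B.
    rewrite big_mkcond [RHS]big_mkcond; apply: eq_bigr => B _; rewrite inE.
    case: (B \in K) => //=; case: (boolP (initial s B)) => sB; last first.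
      by rewrite big1 // => A _; rewrite andbF muln0.
    rewrite big_mkcond [RHS]big_mkcond; apply: eq_bigr => A _; rewrite inE andbT.
    by case: (A \in K) => //=; case: (e A B); case: (initial s A); rewrite ?muln1 ?muln0.
  have := chain_card_le ch; have := proper_pairs_le_weight (subset_trans MK KF).
  have : (M != set0) <= (if s \in H then 1 else 0).
    case: (boolP (M != set0)) => // /set0Pn[B]; rewrite !inE => /andP[BK sB].
    by have -> : [exists B in K, initial s B] by apply/exists_inP; exists B.
  rewrite -/e -/w; move: (\sum_(B in M) _) (nat_of_bool (M != set0)) (if _ then 1 else 0) => x1 x2 x3.
  by move: #|M| #|proper_pairs M|; lia.
have per B : B \in K -> 18 * n`! + \sum_(A in K | e A B) w A B * (C * c2 A B) <= 2 * (C * c B).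
  move=> BK; have hB : 9 * n`! <= C * c B.
    have := card_initial_ge B; have := bin_le_central n #|B|; rewrite -/(c B) /C; nia.
  have : \sum_(A in K | e A B) w A B * (C * c2 A B) <=
         \sum_(A in K | e A B) w A B * (C * c B - 9 * n`!).
    apply: leq_sum => A /andP[AK /and4P[_ _ AB cAB]]; rewrite leq_mul2l; apply/orP; right.
    have N (X Y : {set 'I_n}) : X \in K -> Y \notin K -> X != Y.
      by move=> XK; apply: contra => /eqP <-.
    have := card_initial_pair_le n29 AB cAB (N _ _ AK K0) (N _ _ AK KT) (N _ _ BK K0) (N _ _ BK KT).
    rewrite -/(c2 A B) -/(c B) -/C; lia.
  rewrite -big_distrl /=.
  have : \sum_(A in K | e A B) w A B <= 2.
    apply: leq_trans (sum_edge_weight (@comparability_sym n F) (light _ BK)).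
    rewrite big_mkcond [leqRHS]big_mkcond; apply: leq_sum => A _.
    by rewrite -/e; case: (A \in K) => //=; case: ifP.
  move: (C * c B) (\sum_(A in K | e A B) w A B) (\sum_(A in K | _) _) hB => x y z hB y2 zy.
  have := leq_mul y2 (leqnn (x - 9 * n`!)); lia.
have tot : 18 * n`! * #|K| + \sum_(B in K) \sum_(A in K | e A B) w A B * (C * c2 A B)
    <= 2 * (C * \sum_(B in K) c B).
  rewrite mulnC -sum_nat_const -big_split /= !big_distrr /=; exact: leq_sum.
have E : \sum_(B in K) \sum_(A in K | e A B) w A B * (C * c2 A B) =
    C * \sum_(B in K) \sum_(A in K | e A B) w A B * c2 A B.
  rewrite big_distrr; apply: eq_bigr => B _; rewrite big_distrr; apply: eq_bigr => A _ /=.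
  by rewrite mulnCA.
rewrite E in tot; move: (\sum_(B in K) c B) (\sum_(B in K) _) bonf tot => S1 S2 bonf tot.
nia.
Qed.

(* A 4-chain has six edges but only four vertices to hit, so hitting [K] itself
   would not be enough: the convex hull of [K] is needed. *)
Definition hull_hits n (K : {set {set 'I_n}}) : {set 'S_n} :=
  [set s : 'S_n | [exists A in K, exists D in K, exists S : {set 'I_n},
    [&& A \subset S, S \subset D & initial s S]]].

Lemma hull_hitsP n (K : {set {set 'I_n}}) (s : 'S_n) :
  reflect (exists A D S : {set 'I_n},
    [/\ A \in K, D \in K, A \subset S, S \subset D & initial s S]) (s \in hull_hits K).
Proof.
rewrite inE; apply: (iffP exists_inP) => [[A AK /exists_inP[D DK /existsP[S /and3P[h1 h2 h3]]]]|].
  by exists A, D, S.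
move=> [A [D [S [AK DK h1 h2 h3]]]]; exists A => //; apply/exists_inP; exists D => //.
by apply/existsP; exists S; rewrite h1 h2.
Qed.

Lemma hull_hits_interval n (K : {set {set 'I_n}}) (A D : {set 'I_n}) :
  A \in K -> D \in K -> A \subset D ->
  n`! <= 'C(n - #|D :\: A|, #|A|) * #|hull_hits K|.
Proof.
move=> AK DK AD; apply: leq_trans (card_meets_interval AD) _.
rewrite leq_mul2l; apply/orP; right; apply: subset_leq_card; apply/subsetP => s.
by rewrite inE => /existsP[S /and3P[h1 h2 h3]]; apply/hull_hitsP; exists A, D, S.
Qed.

(** * Bounds for single components *)

(** Among the six pairs of the four vertices only [X], [Z] may be incomparable. If they are, there
    are at most 5 edges and [B], [X], [Y] form a 3-chain; otherwise the four vertices form a 4-chain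
    with 6 edges. Pairwise comparability makes these sets chains whatever their order. *)
Lemma heavy_component_bound n (F K : {set {set 'I_n}}) (B : {set 'I_n}) : 5 <= n ->
    path_free 5 F -> K \subset F -> (forall A, A \in F -> (A \in K) = connect (comparability F) B A) ->
    B \in K -> heavy (comparability F) B ->
  #|proper_pairs K| * n`! <= 5 * 'C(n - 2, n./2 - 1) * #|hull_hits K|.
Proof.
move=> n5 free KF KE BK; set e := comparability F; have esym : symmetric e := @comparability_sym n F.
have eirr : irreflexive e := @comparability_irr n F.
move=> /(heavy_component esym eirr (path_free_no_path5 free)).
move=> [X [Y [Z [us [BX BY BZ] XY YZ conn]]]].
have KL A : A \in K -> A \in [:: B; X; Y; Z].
  by move=> AK; apply: conn; rewrite -KE // (subsetP KF).
have nbrK A A' : A \in K -> e A A' -> A' \in K.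
  move=> AK AA'; have A'F : A' \in F by case/and4P: AA'.
  rewrite KE //; apply: connect_trans (connect1 AA'); by rewrite -KE // (subsetP KF).
have [XK YK ZK] : [/\ X \in K, Y \in K & Z \in K] by split; apply: nbrK BK _.
have eC A A' : e A A' -> (A \subset A') || (A' \subset A) by case/and4P.
have chB (s : seq {set 'I_n}) : pairwise e s -> {in s &, forall A A' : {set 'I_n}, (A \subset A') || (A' \subset A)}.
  move=> /(pairwiseP set0) h A A' As As'.
  have [i ile <-] : exists2 i, i < size s & nth set0 s i = A.
    by exists (index A s); rewrite ?index_mem ?nth_index.
  have [j jle <-] : exists2 j, j < size s & nth set0 s j = A'.
    by exists (index A' s); rewrite ?index_mem ?nth_index.
  case: (ltngtP i j) => [ij|ij|->]; last by rewrite subxx.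
    by apply: eC; apply: h.
  by rewrite orbC; apply: eC; apply: h.
(* [o] orients an edge upwards, so listing the edges bounds the number of proper pairs. *)
pose o (A A' : {set 'I_n}) := if A \proper A' then (A, A') else (A', A).
have ppo p : p \in proper_pairs K -> exists A A', [/\ A \in K, A' \in K, e A A' & p = (A, A')].
  case: p => A A'; rewrite inE => /and3P[/= AK A'K pA]; exists A, A'; split=> //.
  apply/and4P; rewrite !(subsetP KF) // proper_sub //; split=> //.
  by move: pA; rewrite properEneq => /andP[].
have inO (l : seq ({set 'I_n} * {set 'I_n})) :
    (forall A A', A \in K -> A' \in K -> e A A' -> (o A A' \in l)) ->
    #|proper_pairs K| <= size l.
  move=> h; apply: leq_trans (card_size l); apply: subset_leq_card; apply/subsetP => p.
  rewrite !inE => hp; have [A [A' [AK A'K AA' E]]] := ppo p ltac:(by rewrite inE).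
  have := h _ _ AK A'K AA'; rewrite /o; move: hp; rewrite E /= => /and3P[_ _ ->] //.
have oC A A' : e A A' -> o A A' = o A' A.
  move=> /and4P[_ _ ne /orP[] s]; rewrite /o !properEneq s [A' == A]eq_sym ne /=;
    by case: ifP => // s'; rewrite eqEsubset s s' in ne.
have [XZ|XZ] := boolP (e X Z); last first.
  have le5 : #|proper_pairs K| <= 5.
    apply: (inO [:: o B X; o B Y; o B Z; o X Y; o Y Z]) => A A' /KL + /KL.
    rewrite !inE => /or4P[] /eqP -> /or4P[] /eqP -> h; rewrite ?eqxx ?orbT //;
      try (by rewrite eirr in h);
      try (by rewrite oC // eqxx ?orbT); by rewrite ?(negbTE XZ) // esym (negbTE XZ) in h.
  have [|||A [D [As Ds AD sz]]] := @chain_spread _ [:: B; X; Y] => //.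
  - by move: us; rewrite -[X in uniq X]/([:: B; X; Y] ++ [:: Z]) cat_uniq => /and3P[].
  - by apply: chB; rewrite /= BX BY XY.
  have sub A' : A' \in [:: B; X; Y] -> A' \in K by rewrite !inE => /or3P[] /eqP ->.
  have h1 := hull_hits_interval (sub _ As) (sub _ Ds) AD.
  have := @central_bin_drop2 n #|D :\: A| #|A| sz.
  move: h1; move: (#|proper_pairs K|) le5 (n`!) (#|hull_hits K|) => p p5 N H h1 h2.
  by rewrite -mulnA; apply: leq_mul p5 (leq_trans h1 (leq_mul h2 (leqnn H))).
have le6 : #|proper_pairs K| <= 6.
  apply: (inO [:: o B X; o B Y; o B Z; o X Y; o Y Z; o X Z]) => A A' /KL + /KL.
  rewrite !inE => /or4P[] /eqP -> /or4P[] /eqP -> h; rewrite ?eqxx ?orbT //;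
      try (by rewrite eirr in h);
      by rewrite oC // eqxx ?orbT.
have [|||A [D [As Ds AD sz]]] := @chain_spread _ [:: B; X; Y; Z] => //.
  by apply: chB; rewrite /= BX BY XY BZ XZ YZ.
have sub A' : A' \in [:: B; X; Y; Z] -> A' \in K by rewrite !inE => /or4P[] /eqP ->.
have h1 := hull_hits_interval (sub _ As) (sub _ Ds) AD.
have := @central_bin_drop3 n #|D :\: A| #|A| n5 sz.
move: h1; move: (#|proper_pairs K|) le6 (n`!) (#|hull_hits K|) => p p6 N H h1 h2.
by apply: leq_trans (leq_mul p6 h1) _; rewrite mulnA; apply: leq_mul.
Qed.

(** The charges give at most [#|K|] pairs. The estimate for hits loses a factor 10/9, and 4 * 10/9
    is still below 5. *)
Lemma light_component_bound n (F K : {set {set 'I_n}}) : 29 <= n -> K \subset F ->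
    {in K, forall B, ~~ heavy (comparability F) B} ->
  #|proper_pairs K| * n`! <= 5 * 'C(n - 2, n./2 - 1) * #|hull_hits K|.
Proof.
move=> n29 KF light.
have le_card : #|proper_pairs K| <= #|K|.
  rewrite -(@leq_pmul2l 2) //; apply: leq_trans (proper_pairs_le_weight KF) _.
  rewrite mulnC -sum_nat_const; apply: leq_sum => B BK.
  apply: leq_trans (sum_edge_weight (@comparability_sym n F) (light _ BK)).
  by rewrite big_mkcond [leqRHS]big_mkcond; apply: leq_sum => A _; case: (A \in K) => //=; case: ifP.
pose K' := K :\ set0 :\ setT.
have K'K : K' \subset K by apply: subset_trans (subD1set _ _) (subD1set _ _).
have light' : {in K', forall B, ~~ heavy (comparability F) B}.
  by move=> B /(subsetP K'K); apply: light.
have := @card_light_le n F K' n29 (subset_trans K'K KF).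
rewrite !inE !eqxx !andbF => /(_ isT isT light') bound.
have {}bound : 9 * n`! * #|K'| <= 10 * 'C(n, n./2) * #|hull_hits K|.
  apply: leq_trans bound _; rewrite leq_mul2l; apply/orP; right.
  apply: subset_leq_card; apply/subsetP => s; rewrite inE => /exists_inP[B /(subsetP K'K) BK sB].
  by apply/hull_hitsP; exists B, B, B.
have c4 := @central_bin_le4 n ltac:(lia).
(* If [K] contains the empty or the full set, every chain hits it and up to two members escape the
   estimate. The slack 5 - 40/9 = 5/9 times this binomial must absorb them, which requires it to be
   at least 18/5. *)
have big : 4 <= 'C(n - 2, n./2 - 1).
  by apply: leq_trans (leq_bin_row (n := n - 2) (m := n./2 - 1) _); lia.
have N0 := fact_gt0 n.
have cK : #|K| = (setT \in K :\ set0) + (set0 \in K) + #|K'|.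
  by rewrite (cardsD1 set0 K) (cardsD1 setT (K :\ set0)) addnCA addnA.
have [hK|hK] := boolP ((set0 \in K) || (setT \in K)); last first.
  have : #|K| = #|K'| by rewrite cK; move: hK; rewrite !inE negb_or => /andP[/negbTE -> /negbTE ->]; rewrite andbF.
  move: bound c4 le_card; move: #|K| #|K'| #|proper_pairs K| #|hull_hits K| (n`!).
  move: 'C(n, _) 'C(n - 2, _) => C c k k' p H N bound c4 pk kk.
  have h1 := leq_mul c4 (leqnn H); have h2 : N * p <= N * k' by rewrite leq_mul2l; lia.
  lia.
have hits : #|hull_hits K| = n`!.
  rewrite -card_Sn; apply: eq_card => s; rewrite [RHS]inE.
  case/orP: hK => hK; apply/hull_hitsP.
    by exists set0, set0, set0; rewrite hK subxx initial0.
  by exists setT, setT, setT; rewrite hK subxx initialT.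
rewrite hits in bound *; rewrite leq_mul2r; apply/orP; right.
have {}bound : 9 * #|K'| <= 10 * 'C(n, n./2).
  by rewrite -(leq_pmul2r N0); move: bound; rewrite -!mulnA [n`! * _]mulnC.
have : #|K| <= 2 + #|K'| by rewrite cK leq_add2r; case: (_ \in _); case: (_ \in _).
lia.
Qed.

(** * Summation over the components *)

Lemma copies_P2_le n (F : {set {set 'I_n}}) : 29 <= n -> path_free 5 F ->
  copies_P2 F <= 5 * 'C(n - 2, n./2 - 1).
Proof.
move=> n29 free; set e := comparability F; set c := 5 * _.
have csym : connect_sym e by apply: sym_connect_sym; apply: comparability_sym.
(* The index [r] runs over all subsets; [K r] is empty unless [r] is the root of some member of
   [F]. *)
pose K r := [set A in F | fingraph.root e A == r].
have KF r : K r \subset F by apply/subsetP => A; rewrite inE => /andP[].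
have comp r : #|proper_pairs (K r)| * n`! <= c * #|hull_hits (K r)|.
  have [/exists_inP[B BK hB]|/exists_inPn light] := boolP [exists B in K r, heavy e B].
    apply: (heavy_component_bound _ free (KF r) _ BK hB); first lia.
    move=> A AF; move: BK; rewrite !inE AF => /andP[_ /eqP <-] /=.
    by rewrite eq_sym root_connect.
  by apply: light_component_bound (KF r) _.
have rootE A B : A \in F -> B \in F -> A \subset B -> fingraph.root e A = fingraph.root e B.
  move=> AF BF AB; have [->//|ne] := eqVneq A B; apply/(fingraph.rootP csym); apply: connect1.
  by rewrite /e /comparability AF BF ne AB.
have total : copies_P2 F = \sum_r #|proper_pairs (K r)|.
  rewrite /copies_P2 -sum1_card (partition_big (fun p => fingraph.root e p.1) predT) //=.
  apply: eq_bigr => r _; rewrite sum1_card; apply: eq_card => -[A B]; rewrite unfold_in !inE /=.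
  apply/idP/idP; last by move=> /and3P[/andP[-> ->] /andP[-> _] ->].
  move=> /andP[/and3P[AF BF AB] rA].
  by rewrite AF BF AB rA -(rootE A B) ?rA //; apply: proper_sub.
have disj : \sum_r #|hull_hits (K r)| <= n`!.
  have -> : \sum_r #|hull_hits (K r)| = \sum_(r in [set: {set 'I_n}]) #|[set s | s \in hull_hits (K r)]|.
    by apply: eq_big => [r|r _]; rewrite ?inE //; apply: eq_card => s; rewrite [RHS]inE.
  rewrite double_count -card_Sn -sum1_card; apply: leq_sum => s _.
  apply/card_le1_eqP => r1 r2; rewrite !in_set /= => h1 h2.
  have {h1}/hull_hitsP[A1 [D1 [S1 [A1K D1K a1 d1 i1]]]] : s \in hull_hits (K r1) by rewrite inE.
  have {h2}/hull_hitsP[A2 [D2 [S2 [A2K D2K a2 d2 i2]]]] : s \in hull_hits (K r2) by rewrite inE.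
  move: A1K D1K A2K D2K; rewrite !inE => /andP[A1F /eqP <-] /andP[D1F /eqP rD1].
  move=> /andP[A2F /eqP rA2] /andP[D2F /eqP rD2].
  (* Two initial sets in the hulls are nested, so the lower end of one hull lies below the upper end
     of the other; these ends are then in the same component. *)
  case/orP: (initial_total i1 i2) => S12.
    by rewrite -rD2; apply/esym/rootE => //; apply: subset_trans a1 (subset_trans S12 d2).
  by rewrite -rD1 -rA2; apply: rootE => //; apply: subset_trans a2 (subset_trans S12 d1).
rewrite -(leq_pmul2r (fact_gt0 n)) total big_distrl /=.
apply: (@leq_trans (\sum_r c * #|hull_hits (K r)|)); first by apply: leq_sum => r _.
by rewrite -big_distrr leq_mul2l disj orbT.
Qed.

(** * Lower bound *)

(* The disjoint union of the intervals [T, T + {x, y}] with [#|T| = k]. *)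
Definition diamonds n (x y : 'I_n) (k : nat) : {set {set 'I_n}} :=
  [set S : {set 'I_n} | #|S :\: [set x; y]| == k].

(** Comparable members agree outside [x], [y], since their parts there are nested and of equal size.
    A path thus stays within one interval, which has only four members. *)
Lemma diamonds_path_free n (x y : 'I_n) k : path_free 5 (diamonds x y k).
Proof.
move=> d P [s [sbij adj]] [f [finj fF fle]].
pose t i := f (s i) :\: [set x; y].
have comp (A B : {set 'I_n}) : A \in diamonds x y k -> B \in diamonds x y k ->
    A \subset B -> A :\: [set x; y] = B :\: [set x; y].
  rewrite !inE => /eqP cA /eqP cB AB; apply: subset_cardE; last by rewrite cA cB.
  by rewrite setSD.
have tS (i j : 'I_5) : j = i.+1 :> nat -> t i = t j.
  move=> ij; have := adj i j; rewrite ij eqxx /hasse_adj /= => /orP[] /andP[/Order.POrderTheory.ltW/fle h _].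
    by apply: comp.
  by apply/esym/comp.
have t0 (i : 'I_5) : t i = t ord0.
  case: i => m; elim: m => [|m IH] h; first by congr t; apply: ord_inj.
  by rewrite -(IH (ltnW h)); apply/esym/tS.
have := @leq_card _ _ (fun i : 'I_5 => (x \in f (s i), y \in f (s i))).
rewrite card_prod card_bool card_ord => h; suff : 5 <= 2 * 2 by [].
apply: h => i j [hx hy]; apply: (bij_inj sbij); apply: finj; apply/setP => z.
have /setP/(_ z) : t i = t j by rewrite !t0.
rewrite !inE; have [->|zx] := eqVneq z x; first by rewrite hx.
by have [->|zy] := eqVneq z y; first by rewrite hy.
Qed.

(** Each of the ['C(n - 2, k)] intervals contributes its four covering pairs and the pair of bottom
    and top. *)
Lemma copies_P2_diamonds n (x y : 'I_n) k : x != y ->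
  5 * 'C(n - 2, k) <= copies_P2 (diamonds x y k).
Proof.
move=> xy; pose Y := ~: [set x; y]; pose D := [set T : {set 'I_n} | T \subset Y & #|T| == k].
have cY : #|Y| = n - 2 by rewrite cardsCs setCK card_ord cards2 xy.
rewrite -cY -cards_draws -/D mulnC -sum_nat_const /copies_P2 -sum1_card.
rewrite (partition_big (fun p => p.1 :\: [set x; y]) (mem D)) /=; last first.
  move=> p; rewrite !inE => /and3P[-> _ _]; rewrite andbT; apply/subsetP => z.
  by rewrite !inE => /andP[].
apply: leq_sum => T; rewrite inE => /andP[/subsetP TY cT].
have [xT yT] : x \notin T /\ y \notin T.
  by split; apply/negP => /TY; rewrite !inE eqxx ?orbT.
have yx : (y == x) = false by rewrite eq_sym; apply/negbTE.
pose g (U : {set 'I_n}) := U :|: T.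
have gT (U : {set 'I_n}) : U \subset [set x; y] -> g U :\: [set x; y] = T.
  move=> /subsetP Uxy; apply/setP => z; rewrite !inE.
  have [zU|zU] := boolP (z \in U).
    have := Uxy z zU; rewrite !inE => zxy; rewrite zxy; apply/esym/negbTE/negP => /TY.
    by rewrite !inE zxy.
  by have [/TY|] := boolP (z \in T); rewrite ?andbF // !inE => ->.
pose l := [:: (g set0, g [set x]); (g set0, g [set y]); (g set0, g [set x; y]);
              (g [set x], g [set x; y]); (g [set y], g [set x; y])].
have ul : uniq l.
  (* The five pairs are told apart by which of [x] and [y] their two components contain. *)
  apply: (@map_uniq _ _ (fun p : {set 'I_n} * {set 'I_n} => (x \in p.1, y \in p.1, x \in p.2, y \in p.2))).
  by rewrite /l /= !inE (negbTE xT) (negbTE yT) !eqxx (negbTE xy) yx.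
rewrite sum1_card -[5]/(size l) -(card_uniqP ul); apply: subset_leq_card; apply/subsetP => p pl.
have [U [V [-> Uxy Vxy UV]]] : exists U V, [/\ p = (g U, g V), U \subset [set x; y],
    V \subset [set x; y] & g U \proper g V].
  have sx : [set x] \subset [set x; y] by rewrite sub1set !inE eqxx.
  have sy : [set y] \subset [set x; y] by rewrite sub1set !inE eqxx orbT.
  have pr (U V : {set 'I_n}) z : U \subset V -> z \in V -> z \notin U -> z \notin T -> g U \proper g V.
    move=> UV zV zU zT; apply/properP; split; first exact: setSU.
    by exists z; rewrite !inE ?zV // (negbTE zU).
  move: pl; rewrite !inE => /or4P[/eqP->|/eqP->|/eqP->|/orP[]/eqP->].
  - by exists set0, [set x]; rewrite !sub0set sx (pr _ _ x) ?sub0set ?inE.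
  - by exists set0, [set y]; rewrite !sub0set sy (pr _ _ y) ?sub0set ?inE.
  - by exists set0, [set x; y]; rewrite !sub0set subxx (pr _ _ x) ?sub0set ?inE ?eqxx.
  - by exists [set x], [set x; y]; rewrite subxx sx (pr _ _ y) ?sx ?inE ?eqxx ?orbT ?yx.
  - by exists [set y], [set x; y]; rewrite subxx sy (pr _ _ x) ?sy ?inE ?eqxx.
by rewrite unfold_in !inE /= !gT // cT UV eqxx.
Qed.

Lemma La_path5_P2 n : 29 <= n -> La_path_P2 n 5 = 5 * 'C(n - 2, n./2 - 1).
Proof.
move=> n29; apply/eqP; rewrite eqn_leq; apply/andP; split.
  by apply/bigmax_leqP => F /boolp.asboolP; apply: copies_P2_le.
have [lt0 lt1] : 0 < n /\ 1 < n by lia.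
pose x : 'I_n := Ordinal lt0; pose y : 'I_n := Ordinal lt1.
apply: leq_trans (@copies_P2_diamonds n x y _ _) _ => //.
apply: (@leq_bigmax_cond _ _ (@copies_P2 n)); apply/boolp.asboolP.
exact: diamonds_path_free.
Qed.

(* Asymptotics *)
From mathcomp Require Import classical_sets reals topology normedtype sequences ring lra.
Import Order.TTheory GRing.Theory Num.Theory numFieldNormedType.Exports.
Local Open Scope classical_set_scope.
Local Open Scope ring_scope.

(** The ratio lies between [1/4] and [n / (4 (n - 1))], and the latter is at most [1/4 + 1/(n + 1)]
    for [n >= 2]. *)
Lemma central_bin_ratio_cvg (R : realType) :
  ('C(n - 2, n./2 - 1)%:R / 'C(n, n./2)%:R : R) @[n --> \oo] --> (1 / 4%:R : R).
Proof.
apply: (@squeeze_cvgr _ _ _ _ (fun=> 1 / 4%:R) (fun n => 1 / 4%:R + harmonic n)).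
- near=> n; have n2 : (2 <= n)%N by near: n; exists 2.
  have C0 : 0 < 'C(n, n./2)%:R :> R by rewrite ltr0n central_bin_gt0.
  rewrite ler_pdivlMr // ler_pdivrMr //.
  have := central_bin_le4 n2; have := central_bin_ge4 n2.
  rewrite -!(ler_nat R) !natrM natrB ?(leq_trans _ n2) //.
  move: C0; move: ('C(n, n./2)%:R : R) ('C(n - 2, _)%:R : R) => C c C0 h1 h2.
  rewrite /harmonic /= -(natr1 n).
  have : (2 : R) <= n%:R by rewrite (ler_nat R 2).
  move: (n%:R : R) h1 => N h1 N2; apply/andP; split; first lra.
  have N1 : 0 < N + 1 by lra.
  have E : (1 / 4 + (N + 1)^-1) * C * (N + 1) = (1 / 4 * (N + 1) + 1) * C.
    by field; lra.
  have N3 : 0 < N - 1 by lra.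
  rewrite -(ler_pM2r N1) E -(ler_pM2r N3).
  have : 4 * (N - 1) * c * (N + 1) <= N * C * (N + 1) by rewrite ler_pM2r.
  (* After clearing denominators, [1 / (4 (N - 1)) <= 1 / (N + 1)] reads [0 <= 3 N - 5]. *)
  have : 0 <= (3 * N - 5) * C by apply: mulr_ge0; lra.
  lra.
- exact: cvg_cst.
- rewrite -[X in _ --> X]addr0; apply: cvgD; [exact: cvg_cst|exact: cvg_harmonic].
Unshelve. all: by end_near.
Qed.

Theorem theorem6 (R : realType) :
  exists e : nat -> R,
    e n @[n --> \oo] --> (0 : R) /\
    \forall n \near \oo,
      La_path_P2 n 5 = (5 * 'C(n - 2, n./2 - 1))%N /\
      (5 * 'C(n - 2, n./2 - 1))%:R = (5%:R / 4%:R + e n) * 'C(n, n./2)%:R :> R.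
Proof.
(* The error term is five times the deviation of the binomial ratio from its limit 1/4. *)
exists (fun n => 5%:R * ('C(n - 2, n./2 - 1)%:R / 'C(n, n./2)%:R - 1 / 4%:R)); split.
  rewrite -[X in _ --> X](mulr0 5%:R) -(subrr (1 / 4%:R)).
  apply: cvgM; first exact: cvg_cst.
  by apply: cvgB; [exact: central_bin_ratio_cvg|exact: cvg_cst].
exists 29 => // n /= n29; split; first exact: La_path5_P2.
have C0 : 'C(n, n./2)%:R != 0 :> R by rewrite pnatr_eq0 -lt0n central_bin_gt0.
by rewrite natrM; field.
Qed.
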